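(* Let $(p_{i,j})_{1\le i\le j\le n}$ and $(p'_{i,j})_{1\le i\le j\le n}$ be two reduced families of primitive elements of ${\cal H}_R$, and let $(c_0,\dots,c_k)$ be the type of $(p_{i,j})$, with associated matrices ${\cal P},{\cal P}'$. Then $C_{(p_{i,j})}$ and $C_{(p'_{i,j})}$ are isomorphic comodules if and only if $(p_{i,j})$ and $(p'_{i,j})$ have the same type and there exists $g\in G_{(c_0,\dots,c_k)}$ such that ${\cal P}'=g{\cal P}g^{-1}$.
   Context: A rooted tree is a finite connected and simply connected graph with a distinguished vertex (the root), edges oriented away from the root. ${\cal H}_R$ is the commutative polynomial algebra over $\mathbb{Q}$ on the isomorphism classes of rooted trees; monomials are forests ($1$ is the empty forest), weight = number of vertices. An admissible cut $C$ of a tree $t$ is a nonempty set of edges such that every path from the root to a vertex contains at most one edge of $C$; removing them gives a forest with $R^C(t)$ the tree containing the root and $P^C(t)$ the product of the others. Coproduct: algebra morphism $\Delta$ with $\Delta(t)=1\otimes t+t\otimes1+\sum_CP^C(t)\otimes R^C(t)$; $Prim({\cal H}_R)$ = primitive elements. For forests $M,N$: $M\top N=0$ if $N=1$, else $M\top N=\frac{1}{weight(N)}\sum_vN_v$, $v$ over vertices of $N$, $N_v$ obtained by attaching every tree of $M$ to $v$; bilinear extension; $p_k\top\cdots\top p_1:=(p_k\top\cdots\top p_2)\top p_1$. ${\cal D}_{i,j}$ = set of partitions of $\{i,\dots,j\}$ into consecutive intervals $I_{i_1,j_1}\cdots I_{i_k,j_k}$ ($i=i_1\le j_1$, $i_{r+1}=j_r+1$,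 $j_k=j$). For a family $(p_{i,j})_{1\le i\le j\le n}$ of primitive elements, $C_{(p_{i,j})}$ is the left comodule with basis $e_0,\dots,e_n$, $\Delta(e_0)=1\otimes e_0$, $\Delta(e_i)=\sum_{j=0}^{i-1}\big(\sum_{{\cal D}_{j+1,i}}p_{i_k,j_k}\top\cdots\top p_{i_1,j_1}\big)\otimes e_j+1\otimes e_i$. The associated matrix ${\cal P}\in{\cal M}_{n+1}(Prim({\cal H}_R))$ (rows and columns indexed $0,\dots,n$) has entry $p_{r+1,c}$ at position $(r,c)$ if $c\ge r+1$, and $0$ otherwise. The family is reduced of type $(c_0,\dots,c_k)$ (positive integers with $c_0+\cdots+c_k=n+1$) if, cutting rows and columns into consecutive blocks of sizes $c_0,\dots,c_k$, all blocks on or below the block diagonal are zero and, for each $i=1,\dots,k$, the block in block-row $i-1$ and block-column $i$ (of size $c_{i-1}\times c_i$) has its $c_i$ columns linearly independent as elements of $Prim({\cal H}_R)^{c_{i-1}}$. $G_{(c_0,\dots,c_k)}\subset GL_{n+1}(\mathbb{Q})$ is the group of block upper triangular matrices with respect to these blocks whose diagonal blocks lie in $GL_{c_i}(\mathbb{Q})$; it acts by $g\cdot{\cal P}=g{\cal P}g^{-1}$. *)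

(* Defs.v *)
From HB Require Import structures.
From mathcomp Require Import all_boot all_order all_algebra.
From mathcomp Require Import finmap.
From mathcomp.multinomials Require Import monalg.

Set Implicit Arguments.
Unset Strict Implicit.
Unset Printing Implicit Defensive.

Import Order.TTheory GRing.Theory Num.Theory.
Local Open Scope ring_scope.

(* Rooted trees.  A (planar) rooted tree is a root with an ordered     *)
(* list of subtrees; isomorphism classes of rooted trees are obtained  *)
(* by forgetting the order of children, which we realise by canonical  *)
(* representatives (children recursively canonised and sorted).        *)

Inductive tree : Type := Node of seq tree.

Fixpoint tenc (t : tree) : GenTree.tree unit :=
  let: Node ts := t in GenTree.Node 0 (map tenc ts).

Fixpoint tdec (g : GenTree.tree unit) : tree :=
  match g with
  | GenTree.Leaf _ => Node [::]
  | GenTree.Node _ gs => Node (map tdec gs)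
  end.

Fixpoint tencK (t : tree) : tdec (tenc t) = t :=
  match t return tdec (tenc t) = t with
  | Node ts => f_equal Node
      ((fix F (s : seq tree) : map tdec (map tenc s) = s :=
          match s return map tdec (map tenc s) = s with
          | [::] => erefl
          | x :: s' => f_equal2 cons (tencK x) (F s')
          end) ts)
  end.

HB.instance Definition _ := Countable.copy tree (can_type tencK).

Definition tle (a b : tree) : bool := (choice.pickle a <= choice.pickle b)%N.

Fixpoint canon (t : tree) : tree :=
  let: Node ts := t in Node (sort tle (map canon ts)).

Fixpoint tree_ind2 (P : tree -> Prop)
  (H : forall ts, foldr (fun x acc => P x /\ acc) True ts -> P (Node ts))
  (t : tree) : P t :=
  match t with
  | Node ts => H ts ((fix F (s : seq tree) :
                        foldr (fun x acc => P x /\ acc) True s :=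
                        match s with
                        | [::] => I
                        | x :: s' => conj (tree_ind2 H x) (F s')
                        end) ts)
  end.

Lemma canon_idem (t : tree) : canon (canon t) = canon t.
Proof.
elim/tree_ind2: t => ts IH /=.
have IH' : {in map canon ts, canon =1 id}.
  move=> x /mapP[y yts ->]; elim: ts IH yts => //= z s IHs [Hz Hs].
  by rewrite inE => /orP[/eqP->|/IHs ->].
rewrite map_id_in; last by move=> x; rewrite mem_sort; apply: IH'.
rewrite sorted_sort //; first by move=> a b c; apply: leq_trans.
by apply: sort_sorted => a b; apply: leq_total.
Qed.

Definition ctree := {t : tree | canon t == t}.

Definition toC (t : tree) : ctree :=
  exist (fun u => canon u == u) (canon t) (introT eqP (canon_idem t)).

Fixpoint tsize (t : tree) : nat :=
  let: Node ts := t in (sumn (map tsize ts)).+1.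

(* The Connes-Kreimer Hopf algebra H_R = Q[rooted trees].              *)

Definition forest := {cmonom ctree}.
Definition HR := {malg rat[forest]}.

Definition forestH (s : seq tree) : HR := \prod_(t <- s) << ucm (toC t) >>.

Definition mlist (N : forest) : seq tree :=
  flatten [seq nseq (N u) (val u) | u <- finsupp N].

Definition weight (N : forest) : nat := sumn (map tsize (mlist N)).

(* H_R (x) H_R, realised as H_R[forest] = polynomials in the trees     *)
(* with coefficients in H_R: a (x) b  |->  sum_m (b_m a) X^m.           *)
Definition HH := {malg HR[forest]}.

Definition tens (a b : HR) : HH :=
  \sum_(m <- msupp b) << (b@_m *: a) *g m >>.

Definition cartprod (A : Type) (l : seq (seq A)) : seq (seq A) :=
  foldr (fun l acc => [seq x :: y | x <- l, y <- acc]) [:: [::]] l.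

(* All cuts (including the empty cut) of a planar tree, as pairs        *)
(* (P^C, R^C): for each child u of the root, either the edge to u is    *)
(* cut (u goes to P^C), or it is kept and a cut is chosen inside u.     *)
(* This enumerates bijectively the sets C of edges meeting every path   *)
(* from the root in at most one edge; the empty cut gives ([::], t).    *)
Fixpoint gcuts (t : tree) : seq (seq tree * tree) :=
  let: Node ts := t in
  [seq (flatten (map fst ch), Node (pmap snd ch)) |
     ch <- cartprod (map (fun u => ([:: u], None) ::
                           [seq (c.1, Some c.2) | c <- gcuts u]) ts)].

(* Delta(t) = 1 (x) t + t (x) 1 + sum_{C nonempty} P^C(t) (x) R^C(t)    *)
Definition coprodT (t : ctree) : HH :=
  tens (<< ucm t >>) 1 +
  \sum_(c <- gcuts (val t)) tens (forestH c.1) (forestH [:: c.2]).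

Definition coprodM (m : forest) : HH :=
  \prod_(u <- finsupp m) coprodT u ^+ m u.

Definition coprod (h : HR) : HH :=
  \sum_(m <- msupp h) ((h@_m)%:MP : HR) *: coprodM m.

Definition primitive (p : HR) : Prop := coprod p = tens 1 p + tens p 1.

Fixpoint grafts (t : tree) (M : seq tree) : seq tree :=
  let: Node ts := t in
  Node (ts ++ M) ::
  [seq Node s | s <- (fix G (s : seq tree) : seq (seq tree) :=
                        match s with
                        | [::] => [::]
                        | u :: s' => [seq g :: s' | g <- grafts u M] ++
                                     [seq u :: r | r <- G s']
                        end) ts].

Definition topF (M N : forest) : HR :=
  if N == onecm ctree then 0 else
  let L := mlist N in
  ((weight N)%:R^-1 : rat) *:
    \sum_(i < size L) \sum_(g <- grafts (nth (Node [::]) L i) (mlist M))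
        forestH (set_nth (Node [::]) L i g).

Definition top (a b : HR) : HR :=
  \sum_(m <- msupp a) \sum_(m' <- msupp b) (a@_m * b@_m') *: topF m m'.

(* topseq [:: x_1; ...; x_k] = x_k T ... T x_1 = (x_k T ... T x_2) T x_1 *)
Fixpoint topseq (s : seq HR) : HR :=
  match s with
  | [::] => 0
  | x :: s' => match s' with [::] => x | _ => top (topseq s') x end
  end.

(* D_{i,j}: partitions of {i,...,j} into consecutive intervals          *)
(* [:: (i_1,j_1); ...; (i_k,j_k)] with i_1 = i, i_{r+1} = j_r+1, j_k = j *)
Fixpoint compsF (fuel i j : nat) : seq (seq (nat * nat)) :=
  match fuel with
  | 0 => [::]
  | f.+1 => if (j < i)%N then [:: [::]] else
      flatten [seq [seq (i, j1) :: c | c <- compsF f j1.+1 j]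
              | j1 <- iota i (j.+1 - i)]
  end.

Definition comps (i j : nat) := compsF (j.+1 - i).+1 i j.

(* The comodule C_(p_{i,j}).  A left H_R-comodule structure on Q^(n+1) *)
(* with basis e_0..e_n is encoded by its coaction matrix A over H_R:    *)
(* Delta(e_i) = sum_j A i j (x) e_j.                                   *)

Definition coact (n : nat) (p : nat -> nat -> HR) : 'M[HR]_n.+1 :=
  \matrix_(r, c) if (c < r)%N then
                   \sum_(D <- comps c.+1 r) topseq [seq p d.1 d.2 | d <- D]
                 else if r == c then 1 else 0.

Definition ratH (q : rat) : HR := q%:MP.

(* a Q-linear map f (matrix in the bases e and e', f(e_i) = sum_k       *)
(* f i k e'_k) is a comodule morphism iff Delta' o f = (id (x) f) o      *)
(* Delta, i.e. A *m f = f *m A'.                                        *)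
Definition comod_hom (m k : nat) (A : 'M[HR]_m) (A' : 'M[HR]_k)
  (f : 'M[rat]_(m, k)) : Prop :=
  A *m map_mx ratH f = map_mx ratH f *m A'.

Definition comod_isomorphic (n : nat) (p p' : nat -> nat -> HR) : Prop :=
  exists f : 'M[rat]_n.+1, f \in unitmx /\ comod_hom (coact n p) (coact n p') f.

Definition prim_family (n : nat) (p : nat -> nat -> HR) : Prop :=
  forall i j, (1 <= i)%N -> (i <= j)%N -> (j <= n)%N -> primitive (p i j).

Definition Pmat (n : nat) (p : nat -> nat -> HR) : 'M[HR]_n.+1 :=
  \matrix_(r, c) if (r < c)%N then p r.+1 c else 0.

Definition is_type (n : nat) (c : seq nat) : bool :=
  all (fun x => 0 < x)%N c && (sumn c == n.+1).

Definition blk (c : seq nat) (r : nat) : nat :=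
  count (fun i => sumn (take i.+1 c) <= r)%N (iota 0 (size c)).

Definition reduced_of_type (n : nat) (p : nat -> nat -> HR) (c : seq nat)
  : Prop :=
  [/\ prim_family n p, is_type n c,
      (forall r s : 'I_n.+1, (blk c s <= blk c r)%N -> Pmat n p r s = 0) &
      (forall i, (0 < i < size c)%N ->
         forall lam : 'I_n.+1 -> rat,
           (forall r : 'I_n.+1, blk c r = i.-1 ->
              \sum_(s : 'I_n.+1 | blk c s == i) lam s *: Pmat n p r s = 0) ->
           forall s : 'I_n.+1, blk c s = i -> lam s = 0)].

Definition blk_idx (n : nat) (c : seq nat) (i : nat) :
  'I_(nth 0%N c i) -> 'I_n.+1 := fun j => inord (sumn (take i c) + j).

Arguments blk_idx n c i j : clear implicits.

Definition in_G (n : nat) (c : seq nat) (g : 'M[rat]_n.+1) : Prop :=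
  [/\ g \in unitmx,
      (forall r s : 'I_n.+1, (blk c s < blk c r)%N -> g r s = 0) &
      (forall i, (i < size c)%N ->
         mxsub (blk_idx n c i) (blk_idx n c i) g \in unitmx)].

Arguments in_G n c g : clear implicits.

(* Main.v *)
Require Import Defs.
From HB Require Import structures.
From mathcomp Require Import all_boot all_order all_algebra.
From mathcomp Require Import fingroup perm.
From mathcomp Require Import finmap.
From mathcomp.multinomials Require Import monalg.
(** Let U be the strictly upper triangular part of the transposed coaction
matrix.  Splitting off the first interval of a partition gives the recursion
U = P + P * U, where P is the associated matrix and * is the matrix product
built from the operation top.  As * is bilinear over Q, conjugation by g
preserves this recursion; as P and U are strictly upper triangular, each of
them determines the other.  Hence the comodules are isomorphic iff P and P' are
conjugate under GL_{n+1}(Q), and neither the coproduct nor primitivity matters.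
For a reduced family, P lowers the filtration of Q^(n+1) by blocks of
coordinates by exactly one step, so an intertwiner g maps the filtration of P
onto that of P': comparing dimensions, the types agree and g is block
triangular. *)

Set Implicit Arguments.
Unset Strict Implicit.
Unset Printing Implicit Defensive.

Import GRing.Theory.
Local Open Scope fset_scope.
Local Open Scope ring_scope.

(** * Bilinearity of [top] over the rationals *)

(** Finite sets containing the supports give several arguments one common range of summation; the
    extra coefficients are 0. *)
Lemma topEw (E F : {fset forest}) (a b : HR) :
  (msupp a `<=` E)%fset -> (msupp b `<=` F)%fset ->
  top a b = \sum_(m <- E) \sum_(m' <- F) (a@_m * b@_m') *: topF m m'.
Proof.
move=> aE bF; rewrite /top (big_fset_incl _ aE) => [|m _ /mcoeff_outdom ->]; last first.
  by rewrite big1 // => m' _; rewrite mul0r scale0r.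
apply: eq_bigr => m _; rewrite (big_fset_incl _ bF) // => m' _ /mcoeff_outdom ->.
by rewrite mulr0 scale0r.
Qed.

Lemma top_linearl (b : HR) (x : rat) (a a' : HR) :
  top (x *: a + a') b = x *: top a b + top a' b.
Proof.
pose E := msupp (x *: a + a') `|` (msupp a `|` msupp a').
have sE := fsubsetUr (msupp (x *: a + a')) (msupp a `|` msupp a').
rewrite !(@topEw E (msupp b)) ?fsubsetUl //; last 2 first.
- exact: fsubset_trans (fsubsetUr _ _) sE.
- exact: fsubset_trans (fsubsetUl _ _) sE.
rewrite scaler_sumr -big_split; apply: eq_bigr => m _ /=.
rewrite scaler_sumr -big_split; apply: eq_bigr => m' _ /=.
by rewrite mcoeffD mcoeffZ scalerA mulrA -scalerDl mulrDl.
Qed.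

Lemma top_linearr (a : HR) (x : rat) (b b' : HR) :
  top a (x *: b + b') = x *: top a b + top a b'.
Proof.
pose E := msupp (x *: b + b') `|` (msupp b `|` msupp b').
have sE := fsubsetUr (msupp (x *: b + b')) (msupp b `|` msupp b').
rewrite !(@topEw (msupp a) E) ?fsubsetUl //; last 2 first.
- exact: fsubset_trans (fsubsetUr _ _) sE.
- exact: fsubset_trans (fsubsetUl _ _) sE.
rewrite scaler_sumr -big_split; apply: eq_bigr => m _ /=.
rewrite scaler_sumr -big_split; apply: eq_bigr => m' _ /=.
by rewrite mcoeffD mcoeffZ scalerA mulrCA -scalerDl mulrDr.
Qed.

(** Swapping the arguments allows linearity on the left to be declared as well. *)
Definition topr (b a : HR) : HR := top a b.

HB.instance Definition _ (b : HR) :=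
  GRing.isLinear.Build rat HR HR *:%R (topr b) (top_linearl b).
HB.instance Definition _ (a : HR) :=
  GRing.isLinear.Build rat HR HR *:%R (top a) (top_linearr a).

Lemma top0l (b : HR) : top 0 b = 0. Proof. exact: (linear0 (topr b)). Qed.
Lemma top0r (a : HR) : top a 0 = 0. Proof. exact: linear0. Qed.

Lemma top_suml (I : Type) (r : seq I) (P : pred I) (F : I -> HR) (b : HR) :
  top (\sum_(i <- r | P i) F i) b = \sum_(i <- r | P i) top (F i) b.
Proof. exact: (linear_sum (topr b)). Qed.

Lemma top_sumr (I : Type) (r : seq I) (P : pred I) (F : I -> HR) (a : HR) :
  top a (\sum_(i <- r | P i) F i) = \sum_(i <- r | P i) top a (F i).
Proof. exact: linear_sum. Qed.

Lemma topBl (b a a' : HR) : top (a - a') b = top a b - top a' b.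
Proof. exact: (linearB (topr b)). Qed.

Lemma topBr (a b b' : HR) : top a (b - b') = top a b - top a b'.
Proof. exact: linearB. Qed.

Lemma topZl (x : rat) (a b : HR) : top (ratH x * a) b = ratH x * top a b.
Proof.
rewrite (mul_malgC x a) (mul_malgC x (top a b)).
by rewrite -[x *: a]addr0 top_linearl top0l addr0.
Qed.

Lemma topZr (x : rat) (a b : HR) : top a (ratH x * b) = ratH x * top a b.
Proof.
rewrite (mul_malgC x b) (mul_malgC x (top a b)).
by rewrite -[x *: b]addr0 top_linearr top0r addr0.
Qed.

(** * Matrices over [HR] under the product induced by [top] *)

HB.instance Definition _ := GRing.RMorphism.copy ratH (@malgC forest rat).

(** The factors enter [top] in reverse order because [topseq] puts the first interval on the
    right. *)
Definition topmx (m k l : nat) (P : 'M[HR]_(m, k)) (U : 'M[HR]_(k, l)) :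
    'M[HR]_(m, l) :=
  \matrix_(i, j) \sum_t top (U t j) (P i t).

Local Notation "A ^H" := (map_mx ratH A) (at level 2, format "A ^H").

Lemma topmx_mull (q m k l : nat) (g : 'M[rat]_(q, m)) (P : 'M[HR]_(m, k))
    (U : 'M[HR]_(k, l)) : topmx (g^H *m P) U = g^H *m topmx P U.
Proof.
apply/matrixP => i j; rewrite !mxE.
under eq_bigr do rewrite !mxE top_sumr.
rewrite exchange_big; apply: eq_bigr => s _; rewrite !mxE mulr_sumr.
by apply: eq_bigr => t _; rewrite topZr.
Qed.

Lemma topmx_mulr (m k l q : nat) (P : 'M[HR]_(m, k)) (U : 'M[HR]_(k, l))
    (h : 'M[rat]_(l, q)) : topmx P (U *m h^H) = topmx P U *m h^H.
Proof.
apply/matrixP => i j; rewrite !mxE.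
under eq_bigr do rewrite !mxE top_suml.
rewrite exchange_big; apply: eq_bigr => s _; rewrite !mxE mulr_suml.
by apply: eq_bigr => t _; rewrite mulrC topZl mulrC.
Qed.

Lemma topmx_mulA (m k q l : nat) (P : 'M[HR]_(m, k)) (h : 'M[rat]_(k, q))
    (U : 'M[HR]_(q, l)) : topmx (P *m h^H) U = topmx P (h^H *m U).
Proof.
apply/matrixP => i j; rewrite !mxE.
under eq_bigr do rewrite !mxE top_sumr.
rewrite exchange_big; apply: eq_bigr => s _; rewrite !mxE top_suml.
by apply: eq_bigr => t _; rewrite !mxE mulrC topZr topZl.
Qed.

Lemma topmxBl (m k l : nat) (P Q : 'M[HR]_(m, k)) (U : 'M[HR]_(k, l)) :
  topmx (P - Q) U = topmx P U - topmx Q U.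
Proof.
apply/matrixP => i j; rewrite !mxE -sumrB.
by apply: eq_bigr => t _; rewrite !mxE topBr.
Qed.

Lemma topmxBr (m k l : nat) (P : 'M[HR]_(m, k)) (U V : 'M[HR]_(k, l)) :
  topmx P (U - V) = topmx P U - topmx P V.
Proof.
apply/matrixP => i j; rewrite !mxE -sumrB.
by apply: eq_bigr => t _; rewrite !mxE topBl.
Qed.

(** Row [r] of [topmx P U] involves only rows of [U] of larger index, so the rows vanish one by one,
    starting from the last. *)
Lemma topmx_inj_right (n : nat) (P U : 'M[HR]_n) :
  (forall r s : 'I_n, (s <= r)%N -> P r s = 0) -> U = topmx P U -> U = 0.
Proof.
move=> Pup UE; apply/matrixP => r s; rewrite mxE.
have [m] := ubnP (n - r); elim: m r => // m IH r rm.
rewrite UE mxE big1 // => t _; have [tr|rt] := leqP t r; first by rewrite Pup ?top0r.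
by rewrite IH ?top0l // -ltnS (leq_trans _ rm) // ltnS ltn_sub2l.
Qed.

(** Column [s] of [topmx X U] involves only columns of [X] of smaller index, so the columns vanish
    one by one, starting from the first. *)
Lemma topmx_inj_left (n : nat) (X U : 'M[HR]_n) :
  (forall r s : 'I_n, (s <= r)%N -> U r s = 0) -> X = - topmx X U -> X = 0.
Proof.
move=> Uup XE; apply/matrixP => r s; rewrite mxE.
have [m] := ubnP s; elim: m s => // m IH s sm.
rewrite XE !mxE big1 ?oppr0 // => t _; have [st|ts] := leqP s t; first by rewrite Uup ?top0l.
by rewrite IH ?top0r // (leq_trans ts) // -ltnS.
Qed.

(** * Interval partitions and the recursion for the coaction *)

(** Each recursive call raises [i], so fuel above the length [j.+1 - i] never runs out. *)
Lemma compsF_fuel (f f' i j : nat) :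
  (j.+1 - i < f)%N -> (j.+1 - i < f')%N -> compsF f i j = compsF f' i j.
Proof.
elim: f f' i => [//|f IH] [//|f'] i hf hf' /=; case: ifP => // /negbT; rewrite -leqNgt => ij.
congr flatten; apply/eq_in_map => j1; rewrite mem_iota => /andP[ij1 _].
have lt: (j.+1 - j1.+1 < j.+1 - i)%N by rewrite ltn_sub2l // ltnS.
by congr map; apply: IH; apply: leq_trans lt _; rewrite -ltnS.
Qed.

Lemma comps_cons (i j : nat) : (i <= j)%N ->
  comps i j = flatten [seq [seq (i, j1) :: D | D <- comps j1.+1 j]
                      | j1 <- iota i (j.+1 - i)].
Proof.
move=> ij; rewrite {1}/comps /= ltnNge ij /=.
congr flatten; apply/eq_in_map => j1; rewrite mem_iota => /andP[ij1 _].
congr map; apply: compsF_fuel => //.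
by rewrite ltn_sub2l // ltnS.
Qed.

Lemma comps_nil (i : nat) : comps i.+1 i = [:: [::]].
Proof. by rewrite /comps /= ltnSn. Qed.

(** Before a nonempty tail, [topseq] unfolds to [top] rather than to its one-element case. *)
Lemma comps_neq_nil (i j : nat) (D : seq (nat * nat)) :
  (i <= j)%N -> D \in comps i j -> D != [::].
Proof. by move=> ij; rewrite comps_cons // => /flatten_mapP[j1 _ /mapP[E _ ->]]. Qed.

Definition coact_upper (n : nat) (p : nat -> nat -> HR) : 'M[HR]_n.+1 :=
  (coact n p)^T - 1%:M.

Lemma coact_upperE (n : nat) (p : nat -> nat -> HR) (r s : 'I_n.+1) :
  coact_upper n p r s =
  if (r < s)%N then \sum_(D <- comps r.+1 s) topseq [seq p d.1 d.2 | d <- D]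
  else 0.
Proof.
rewrite !mxE; case: ltnP => rs.
  by rewrite (_ : r == s = false) ?subr0 //; apply/negbTE; rewrite neq_ltn rs.
by rewrite eq_sym; case: eqP; rewrite subrr.
Qed.

(* The first interval of a composition contributes an entry of [Pmat]. *)
Lemma coact_upper_rec (n : nat) (p : nat -> nat -> HR) :
  coact_upper n p = Pmat n p + topmx (Pmat n p) (coact_upper n p).
Proof.
apply/matrixP => r s; rewrite coact_upperE !mxE; case: ltnP => rs; last first.
  rewrite add0r big1 // => t _; rewrite coact_upperE !mxE.
  case: ltnP => ts; last by rewrite top0l.
  by rewrite ltnNge (leq_trans (ltnW ts) rs) top0r.
rewrite comps_cons // big_flatten big_map /=.
under eq_bigr do rewrite big_map.
(* The last choice [j1 = s] leaves only the empty partition and yields the entry [p r.+1 s]; all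
   other choices leave a nonempty tail. *)
rewrite -/(index_iota r.+1 s.+1) big_nat_recr //= comps_nil big_seq1 addrC.
congr (_ + _); rewrite big_geq_mkord.
rewrite (big_ord_widen_cond n.+1 _
  (fun j => \sum_(D <- comps j.+1 s) topseq (p r.+1 j :: [seq p d.1 d.2 | d <- D]))
  (ltnW (ltn_ord s))) big_mkcond.
apply: eq_bigr => t _; rewrite coact_upperE !mxE andbC.
case: (ltnP t s) => ts /=; last by rewrite top0l.
case: (ltnP r t) => rt /=; last by rewrite top0r.
rewrite top_suml; apply: eq_big_seq => D /(comps_neq_nil ts).
by case: D.
Qed.

Lemma coact_upper_strict (n : nat) (p : nat -> nat -> HR) (r s : 'I_n.+1) :
  (s <= r)%N -> coact_upper n p r s = 0.
Proof. by rewrite coact_upperE ltnNge => ->. Qed.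

Lemma Pmat_strict (n : nat) (p : nat -> nat -> HR) (r s : 'I_n.+1) :
  (s <= r)%N -> Pmat n p r s = 0.
Proof. by rewrite mxE ltnNge => ->. Qed.

(** * From comodule isomorphism to conjugacy *)

(** Rational matrices leave [topmx] on both sides, and [h *m g] cancels in the middle. *)
Lemma topmx_rec_conj (n : nat) (P U : 'M[HR]_n) (g h : 'M[rat]_n) :
  h *m g = 1%:M -> U = P + topmx P U ->
  g^H *m U *m h^H =
  g^H *m P *m h^H + topmx (g^H *m P *m h^H) (g^H *m U *m h^H).
Proof.
move=> hg1 UE.
have hgH : h^H *m g^H = 1%:M by rewrite -map_mxM hg1 map_mx1.
have mull := @topmx_mull _ _ _ _ g P U.
have mulr := @topmx_mulr _ _ _ _ (g^H *m P) U h.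
have mulA := @topmx_mulA _ _ _ _ (g^H *m P) h (g^H *m U *m h^H).
(* With [g^H] and [h^H] in place, unification unfolds the arithmetic of [HR] and diverges. *)
move: (g^H) (h^H) hgH mull mulr mulA => G H HG1 mull mulr ->.
rewrite (mulmxA H (G *m U) H) (mulmxA H G U) HG1 mul1mx mulr mull.
by rewrite -mulmxDl -mulmxDr; apply: (congr1 (fun X => G *m X *m H) UE).
Qed.

(** If [U = W], then [X = P - Q] satisfies [X = - topmx X U]; if [P = Q], then [U - W] is fixed by
    [topmx P]. Both vanish by strict triangularity. *)
Lemma topmx_rec_eqP (n : nat) (P Q U W : 'M[HR]_n) :
  (forall r s : 'I_n, (s <= r)%N -> P r s = 0) ->
  (forall r s : 'I_n, (s <= r)%N -> U r s = 0) ->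
  U = P + topmx P U -> W = Q + topmx Q W -> U = W <-> P = Q.
Proof.
move=> Pup Uup UE WE; split=> [UW | PQ]; apply/subr0_eq.
  apply: (topmx_inj_left Uup); rewrite topmxBl opprB.
  have PE : P = U - topmx P U by rewrite {1}UE addrK.
  have QE : Q = U - topmx Q U by rewrite {1}UW {1}WE -UW addrK.
  have subBB (V : zmodType) (u a b : V) : u - a - (u - b) = b - a.
    by rewrite opprB addrC subrKA.
  by rewrite {1}PE {1}QE; apply: subBB.
apply: (topmx_inj_right Pup).
by rewrite topmxBr {1}UE {1}WE -PQ opprD addrACA subrr add0r.
Qed.

Lemma coact_upper_conj (n : nat) (p p' : nat -> nat -> HR) (g h : 'M[rat]_n.+1) :
  h *m g = 1%:M ->
  (coact_upper n p' = g^H *m coact_upper n p *m h^H <->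
   Pmat n p' = g^H *m Pmat n p *m h^H).
Proof.
(* The triangular pair is that of [p']: conjugates by an arbitrary [g] are not known to be
   triangular. *)
move=> hg1; apply: topmx_rec_eqP.
- exact: Pmat_strict.
- exact: coact_upper_strict.
- exact: coact_upper_rec.
- by apply: topmx_rec_conj => //; apply: coact_upper_rec.
Qed.

(** [coact] keeps the coaction of e_i in row i, so a morphism becomes a conjugating matrix after
    transposition; conjugation fixes the subtracted identity. *)
Lemma intertwine_trmx (R : comNzRingType) (n : nat) (A A' g h : 'M[R]_n) :
  g *m h = 1%:M -> h *m g = 1%:M ->
  A *m g^T = g^T *m A' <-> A'^T - 1%:M = g *m (A^T - 1%:M) *m h.
Proof.
move=> gh hg; rewrite mulmxBr mulmxBl mulmx1 gh.
split=> [/(congr1 trmx) | /addIr A'E].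
  by rewrite !trmx_mul trmxK => ->; rewrite -mulmxA gh mulmx1.
by apply: trmx_inj; rewrite !trmx_mul trmxK A'E -(mulmxA _ h) hg mulmx1.
Qed.

Lemma comod_hom_Pmat (n : nat) (p p' : nat -> nat -> HR) (g : 'M[rat]_n.+1) :
  g \in unitmx ->
  comod_hom (coact n p) (coact n p') g^T <->
  Pmat n p' = g^H *m Pmat n p *m (invmx g)^H.
Proof.
move=> ug; apply: iff_trans (coact_upper_conj p p' (mulVmx ug)).
rewrite /comod_hom -map_trmx; apply: intertwine_trmx.
  by rewrite -map_mxM (mulmxV ug) map_mx1.
by rewrite -map_mxM (mulVmx ug) map_mx1.
Qed.

Lemma comod_isomorphicE (n : nat) (p p' : nat -> nat -> HR) :
  comod_isomorphic n p p' <->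
  exists2 g : 'M[rat]_n.+1, g \in unitmx &
    Pmat n p' = g^H *m Pmat n p *m (invmx g)^H.
Proof.
split=> [[f [uf Hf]] | [g ug E]]; last first.
  by exists g^T; split; [rewrite unitmx_tr | apply: (proj2 (comod_hom_Pmat p p' ug))].
have ug : f^T \in unitmx by rewrite unitmx_tr.
exists f^T; first exact: ug.
by apply: (proj1 (comod_hom_Pmat p p' ug)); rewrite (trmxK f).
Qed.

(** * Blocks and the filtration of a reduced family *)

(** By induction on [c]: a coordinate below [x] is in block 0; any other is shifted by [x] and its
    block number drops by one. *)
Lemma ltn_blk (c : seq nat) (k r : nat) : (r < sumn c)%N ->
  (blk c r < k)%N = (r < sumn (take k c))%N.
Proof.
elim: c k r => [//|x c IH] k r rc; rewrite /blk /= take0 addn0 (iotaDl 1 0) count_map.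
have [xr|rx] := leqP x r; last first.
  rewrite (eq_count (a2 := pred0)) ?count_pred0; last first.
    by move=> i /=; rewrite leqNgt (leq_trans rx) // leq_addr.
  by case: k => [|k] //=; rewrite (leq_trans rx) ?leq_addr.
rewrite (eq_count (a2 := fun i => sumn (take i.+1 c) <= r - x)%N); last first.
  by move=> i /=; rewrite leq_subRL.
case: k => [|k] //=.
by rewrite add1n ltnS -[(_ < k)%N]/(blk c (r - x) < k)%N IH ltn_subLR.
Qed.

Lemma blk_lt_size (n : nat) (c : seq nat) (r : 'I_n.+1) :
  is_type n c -> (blk c r < size c)%N.
Proof. by case/andP=> _ /eqP cn; rewrite ltn_blk ?take_size cn. Qed.

Lemma reduced_type (n : nat) (p : nat -> nat -> HR) (c : seq nat) :
  reduced_of_type n p c -> is_type n c.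
Proof. by case. Qed.

(* With F_k the span of the e_s such that blk c s < k: if P lam lies in F_k, then lam lies in F_(k+1). *)
Lemma reduced_filtration (n : nat) (p : nat -> nat -> HR) (c : seq nat) (k : nat)
    (lam : 'I_n.+1 -> rat) :
  reduced_of_type n p c ->
  (forall r : 'I_n.+1, (k <= blk c r)%N -> \sum_s lam s *: Pmat n p r s = 0) ->
  forall s : 'I_n.+1, (k < blk c s)%N -> lam s = 0.
Proof.
move=> [_ ct P0 Pfree] lamP s; have [m] := ubnP (size c - blk c s).
elim: m s => // m IH s sm ks.
have sc := blk_lt_size s ct.
(* Downward induction on blocks: in the rows of the preceding block, columns of lower blocks vanish,
   and on higher blocks [lam] is already 0. What remains is a relation between independent
   columns. *)
apply: (Pfree (blk c s)) => // [|r rs]; first by rewrite (leq_ltn_trans _ ks).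
have kr : (k <= blk c r)%N by rewrite rs -ltnS prednK // (leq_ltn_trans _ ks).
rewrite -[RHS](lamP r kr) [RHS](bigID (fun t : 'I_n.+1 => blk c t == blk c s)) /=.
rewrite [X in _ = _ + X]big1 ?addr0 // => t.
rewrite neq_ltn => /orP[ts|st].
  by rewrite P0 ?scaler0 // rs -ltnS prednK // (leq_ltn_trans _ ks).
rewrite IH ?scale0r //; last exact: ltn_trans ks st.
by rewrite -ltnS (leq_trans _ sm) // ltnS ltn_sub2l.
Qed.

Lemma mulmx_eq_entries (R : pzSemiRingType) (m k l q : nat) (A : 'M[R]_(m, k))
    (B : 'M[R]_(k, l)) (C : 'M[R]_(m, q)) (D : 'M[R]_(q, l)) :
  A *m B = C *m D ->
  forall i j, \sum_t A i t * B t j = \sum_t C i t * D t j.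
Proof. by move=> E i j; have := congr1 (fun M : 'M_(m, l) => M i j) E; rewrite !mxE. Qed.

Lemma ratmxE (m k : nat) (g : 'M[rat]_(m, k)) i j : g^H i j = ratH (g i j).
Proof. by rewrite mxE. Qed.

(** By induction on k, [g] maps F_k into F'_k: for v in F_(k+1), P'gv = gPv lies in F'_k, hence gv
    lies in F'_(k+1) by [reduced_filtration]. *)
Lemma intertwiner_block_triangular (n : nat) (p p' : nat -> nat -> HR)
    (c c' : seq nat) (g : 'M[rat]_n.+1) :
  reduced_of_type n p c -> reduced_of_type n p' c' ->
  Pmat n p' *m g^H = g^H *m Pmat n p ->
  forall r s : 'I_n.+1, (blk c s < blk c' r)%N -> g r s = 0.
Proof.
move=> Rp Rp' gP.
suff H k (r s : 'I_n.+1) : (blk c s < k)%N -> (k <= blk c' r)%N -> g r s = 0.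
  by move=> r s sr; apply: (H _ _ _ sr).
elim: k r s => [r s | k IH r s sk kr]; first by rewrite ltn0.
apply: (reduced_filtration (lam := fun t => g t s) Rp' _ kr) => {kr} r kr.
have [_ _ P0 _] := Rp.
rewrite (eq_bigr (fun t => Pmat n p' r t * g^H t s)); last first.
  by move=> t _; rewrite ratmxE mulrC (mul_malgC (g t s)).
apply: (etrans (mulmx_eq_entries gP r s)).
apply: big1 => t _.
have [st|ts] := leqP (blk c s) (blk c t); first by rewrite P0 ?mulr0.
have -> : g^H r t = 0 by rewrite ratmxE (IH r t (leq_trans ts sk) kr) raddf0.
exact: mul0r.
Qed.

(** * Equality of types by counting *)

(** A nonzero determinant has a nonzero term in its Leibniz expansion. *)
Lemma unitmx_perm_neq0 (F : fieldType) (n : nat) (g : 'M[F]_n) :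
  g \in unitmx -> exists s : 'S_n, forall i, g i (s i) != 0.
Proof.
have [s /forallP gs _ | no] := pickP (fun s : 'S_n => [forall i, g i (s i) != 0]).
  by exists s.
rewrite unitmxE unitfE /determinant big1 ?eqxx // => s _.
have /negbT := no s; rewrite negb_forall => /existsP[i /negPn/eqP gi].
by rewrite (bigD1 i) //= gi mul0r mulr0.
Qed.

Lemma card_blk_lt (n : nat) (c : seq nat) (k : nat) : is_type n c ->
  #|[set s : 'I_n.+1 | (blk c s < k)%N]| = sumn (take k c).
Proof.
case/andP=> _ /eqP cn; rewrite -sum1_card.
have le : (sumn (take k c) <= n.+1)%N by rewrite -cn -{2}(cat_take_drop k c) sumn_cat leq_addr.
rewrite -[RHS]card_ord -sum1_card (big_ord_widen n.+1 (fun=> 1%N) le).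
by apply: eq_bigl => s; rewrite inE ltn_blk ?cn.
Qed.

(** A permutation along nonzero entries of [g] satisfies [blk c' r <= blk c (sg r)], so it pulls the
    first [k] blocks of [c] back into those of [c']. *)
Lemma block_triangular_sumn_le (n : nat) (c c' : seq nat) (g : 'M[rat]_n.+1) (k : nat) :
  is_type n c -> is_type n c' -> g \in unitmx ->
  (forall r s : 'I_n.+1, (blk c s < blk c' r)%N -> g r s = 0) ->
  (sumn (take k c) <= sumn (take k c'))%N.
Proof.
move=> ct ct' /unitmx_perm_neq0[sg gsg] g0; rewrite -!(@card_blk_lt n) //.
rewrite -(card_preimset _ (@perm_inj _ sg)); apply/subset_leq_card/subsetP => r.
rewrite !inE; apply: leq_ltn_trans; rewrite leqNgt.
by apply: contraNN (gsg r) => /g0 ->.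
Qed.

(** Positivity tells the end of a sequence apart from trailing zeros. *)
Lemma sumn_take_inj (c c' : seq nat) :
  all (fun x => 0 < x)%N c -> all (fun x => 0 < x)%N c' ->
  (forall k, sumn (take k c) = sumn (take k c')) -> c = c'.
Proof.
elim: c c' => [|x c IH] [|y c'] //= => [_ /andP[y0 _]|/andP[x0 _] _|] H.
- by have := H 1%N; rewrite /= take0 addn0 => y_0; rewrite -y_0 in y0.
- by have := H 1%N; rewrite /= take0 addn0 => x_0; rewrite x_0 in x0.
case/andP: H => _ cp /andP[_ cp'] H.
have xy : x = y by have := H 1%N; rewrite /= !take0 !addn0.
by rewrite xy (IH c') // => k; have := H k.+1; rewrite /= xy => /addnI.
Qed.

(** * Diagonal blocks and membership in the group *)

Lemma sumn_take_blk (c : seq nat) (i : nat) (j : 'I_(nth 0%N c i)) :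
  (sumn (take i c) + j < sumn (take i.+1 c))%N.
Proof.
have ic : (i < size c)%N.
  (* Past the end of [c], [nth] returns 0 and ['I_0] has no element. *)
  by rewrite ltnNge; apply/negP => /(nth_default 0%N) E; case: j; rewrite E.
by rewrite (take_nth 0%N ic) sumn_rcons ltn_add2l.
Qed.

Lemma sumn_take_le (c : seq nat) (i : nat) : (sumn (take i c) <= sumn c)%N.
Proof. by rewrite -{2}(cat_take_drop i c) sumn_cat leq_addr. Qed.

(** The [inord] in [blk_idx] never takes its default, as the block sizes sum to [n.+1]. *)
Lemma blk_idxE (n : nat) (c : seq nat) (i : nat) (j : 'I_(nth 0%N c i)) :
  is_type n c -> blk_idx n c i j = (sumn (take i c) + j)%N :> nat.
Proof.
case/andP=> _ /eqP cn; rewrite /blk_idx inordK //.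
by rewrite -cn (leq_trans (sumn_take_blk j)) ?sumn_take_le.
Qed.

Lemma blk_blk_idx (n : nat) (c : seq nat) (i : nat) (j : 'I_(nth 0%N c i)) :
  is_type n c -> blk c (blk_idx n c i j) = i.
Proof.
move=> ct; have /andP[_ /eqP cn] := ct.
have lt := ltn_ord (blk_idx n c i j); apply/eqP; rewrite eqn_leq.
rewrite -ltnS ltn_blk ?cn // [X in _ && X]leqNgt ltn_blk ?cn //.
by rewrite !blk_idxE // sumn_take_blk -leqNgt leq_addr.
Qed.

Lemma sum_blk_idx (n : nat) (c : seq nat) (i : nat) (F : 'I_n.+1 -> rat) :
  is_type n c ->
  \sum_(j < nth 0%N c i) F (blk_idx n c i j) = \sum_(t : 'I_n.+1 | blk c t == i) F t.
Proof.
move=> ct; have /andP[_ /eqP cn] := ct.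
have inj : injective (blk_idx n c i).
  by move=> a b /(congr1 val) /=; rewrite !blk_idxE // => /addnI/val_inj.
rewrite [RHS](eq_bigl (fun t => t \in codom (blk_idx n c i))); last first.
  move=> t; apply/eqP/codomP => [ti | [j ->]]; last by rewrite blk_blk_idx.
  have ic : (i < size c)%N by rewrite -ti blk_lt_size.
  have le : (sumn (take i c) <= t)%N by rewrite leqNgt -ltn_blk ?cn // ti ltnn.
  have lt : (t - sumn (take i c) < nth 0%N c i)%N.
    rewrite ltn_subLR // -sumn_rcons -take_nth // -ltn_blk ?cn // ti //.
  exists (Ordinal lt); apply: val_inj; rewrite /= blk_idxE //= subnKC //.
have u : uniq (codom (blk_idx n c i)) by rewrite map_inj_uniq ?enum_uniq.
by rewrite -(big_uniq _ u) big_image.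
Qed.

(** Each diagonal block of [invmx g] inverts that of [g]: in the product, lower blocks drop out by
    triangularity of [g], higher ones by that of [invmx g]. *)
Lemma block_triangular_in_G (n : nat) (c : seq nat) (g : 'M[rat]_n.+1) :
  is_type n c -> g \in unitmx ->
  (forall r s : 'I_n.+1, (blk c s < blk c r)%N -> g r s = 0) ->
  (forall r s : 'I_n.+1, (blk c s < blk c r)%N -> invmx g r s = 0) ->
  in_G n c g.
Proof.
move=> ct ug g0 h0; split=> // i ic;
suff /mulmx1_unit[gu _] : 
    mxsub (blk_idx n c i) (blk_idx n c i) g *m mxsub (blk_idx n c i) (blk_idx n c i) (invmx g) = 1%:M.
  exact: gu.
apply/matrixP => a b; rewrite !mxE.
have -> : a == b = (blk_idx n c i a == blk_idx n c i b).
  by apply/eqP/eqP => [-> // | /(congr1 val)/=]; rewrite !blk_idxE // => /addnI/val_inj.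
have <- : (1%:M : 'M[rat]_n.+1) (blk_idx n c i a) (blk_idx n c i b) = (blk_idx n c i a == blk_idx n c i b)%:R.
  by rewrite mxE.
rewrite -(mulmxV ug) mxE.
under eq_bigr do rewrite !mxE.
rewrite (sum_blk_idx i (fun t => g (blk_idx n c i a) t * invmx g t (blk_idx n c i b)) ct).
rewrite [RHS](bigID (fun t : 'I_n.+1 => blk c t == i)) /= [X in _ = _ + X]big1 ?addr0 //.
move=> t; rewrite neq_ltn => /orP[ti | it].
  by rewrite g0 ?mul0r // blk_blk_idx.
by rewrite h0 ?mulr0 // blk_blk_idx.
Qed.

(** * Intertwining relations and the classification *)

Lemma conjmx_intertwine (R : pzRingType) (n : nat) (P P' g h : 'M[R]_n) :
  h *m g = 1%:M -> P' = g *m P *m h -> P' *m g = g *m P.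
Proof. by move=> hg ->; rewrite -mulmxA hg mulmx1. Qed.

(** Makes the filtration argument available for the inverse, with the two families exchanged. *)
Lemma intertwine_inv (R : pzRingType) (n : nat) (P P' g h : 'M[R]_n) :
  g *m h = 1%:M -> h *m g = 1%:M -> P' *m g = g *m P -> P *m h = h *m P'.
Proof.
move=> gh hg E; rewrite -[P *m h]mul1mx -hg -mulmxA [g *m (P *m h)]mulmxA -E.
by rewrite -(mulmxA P') gh mulmx1.
Qed.

Theorem theorem6p6 (n : nat) (p p' : nat -> nat -> HR) (c : seq nat) :
  reduced_of_type n p c ->
  (exists c' : seq nat, reduced_of_type n p' c') ->
  (comod_isomorphic n p p' <->
   (reduced_of_type n p' c /\
    exists g : 'M[rat]_n.+1,
      in_G n c g /\
      Pmat n p' = map_mx ratH g *m Pmat n p *m map_mx ratH (invmx g))).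
Proof.
move=> Rp [c' Rp']; split; last first.
  case=> _ [g [[ug _ _] E]]; apply: (proj2 (comod_isomorphicE n p p')).
  by exists g.
case/(proj1 (comod_isomorphicE n p p')) => g ug E.
have hg : (invmx g)^H *m g^H = 1%:M by rewrite -map_mxM (mulVmx ug) map_mx1.
have gh : g^H *m (invmx g)^H = 1%:M by rewrite -map_mxM (mulmxV ug) map_mx1.
have gP := conjmx_intertwine hg E.
have hP := intertwine_inv gh hg gP.
have g0 := intertwiner_block_triangular Rp Rp' gP.
have h0 := intertwiner_block_triangular Rp' Rp hP.
have ct := reduced_type Rp; have ct' := reduced_type Rp'.
have uh : invmx g \in unitmx by rewrite unitmx_inv.
(* [g] and its inverse give opposite inequalities between the dimensions of the filtration steps. *)
have cc' : c' = c.
  apply: sumn_take_inj; [by case/andP: ct' | by case/andP: ct |] => k.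
  apply/eqP; rewrite eqn_leq (block_triangular_sumn_le k ct' ct uh h0).
  exact: (block_triangular_sumn_le k ct ct' ug g0).
rewrite cc' in Rp' g0 h0; split; first exact: Rp'.
exists g; split; last exact: E.
exact: block_triangular_in_G.
Qed.
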